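(* Let $p$ be an odd prime. For each positive integer $n$ write $H_n=1+\frac12+\cdots+\frac1n=c_n/d_n$ in lowest terms, let $D_n=\mathrm{lcm}(1,2,\ldots,n)$, and let $q_n=D_n/d_n$ (a positive integer). Define $\mathcal{E}_p=\{n: 1<n<p,\ p\mid c_n\}$ and $\mathcal{Q}_p=\{n\ge 1: p\mid q_n\}$. Let $m\in\mathcal{E}_p$. Then $n\in\mathcal{Q}_p$ for every integer $n$ satisfying $m p^a\le n<(m+1)p^a$ for some integer $a\ge1$. Conversely, if $n\in\mathcal{Q}_p$, then there exist $m\in\mathcal{E}_p$ and an integer $a\ge1$ such that $m p^a\le n<(m+1)p^a$.
   Context: $H_n=c_n/d_n$ with $\gcd(c_n,d_n)=1$; $D_n=\mathrm{lcm}(1,\ldots,n)$; $q_n=D_n/d_n$. *)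

(* Defs.v *)
(* MathComp world. *)
From mathcomp Require Import all_boot all_order all_algebra.

Set Implicit Arguments.
Unset Strict Implicit.
Unset Printing Implicit Defensive.

Import GRing.Theory.

Definition harmonic (n : nat) : rat := (\sum_(1 <= k < n.+1) (k%:R)^-1)%R.

(* [numq] and [denq] are the numerator and denominator in lowest terms, with
   positive denominator. As H_n >= 0, the absolute values below only convert
   from int to nat. *)
Definition harm_num (n : nat) : nat := `|numq (harmonic n)|.
Definition harm_den (n : nat) : nat := `|denq (harmonic n)|.

Definition lcm_upto (n : nat) : nat := \big[lcmn/1%N]_(1 <= k < n.+1) k.

(* The division is exact: see [harm_quoK]. *)
Definition harm_quo (n : nat) : nat := lcm_upto n %/ harm_den n.

Definition E_set (p : nat) : pred nat :=
  [pred n | (1 < n < p) && (p %| harm_num n)].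

Definition Q_set (p : nat) : pred nat :=
  [pred n | (0 < n) && (p %| harm_quo n)].

Lemma harm_numdenE (n : nat) :
  harmonic n = ((harm_num n)%:R / (harm_den n)%:R)%R.
Proof.
have h0 : (0 <= harmonic n)%R.
  apply: Num.Theory.sumr_ge0 => k _.
  by rewrite Num.Theory.invr_ge0 Num.Theory.ler0n.
rewrite /harm_num /harm_den !pmulrn absz_denq gez0_abs ?divq_num_den //.
by rewrite numq_ge0.
Qed.

Lemma coprime_harm (n : nat) : coprime (harm_num n) (harm_den n).
Proof. exact: coprime_num_den. Qed.

Lemma lcm_upto_gt0 (n : nat) : 0 < lcm_upto n.
Proof.
rewrite /lcm_upto big_nat; elim/big_rec: _ => // k x /andP[k0 _] x0.
by rewrite lcmn_gt0 k0.
Qed.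

Lemma dvdn_lcm_upto (n k : nat) : 0 < k <= n -> k %| lcm_upto n.
Proof.
rewrite /lcm_upto; elim: n => [|n IHn] /andP[k0 kn]; first by case: k k0 kn.
rewrite big_nat_recr //=; move: kn; rewrite leq_eqVlt ltnS => /orP[/eqP->|kn].
  exact: dvdn_lcmr.
by apply: dvdn_trans (dvdn_lcml _ _); apply: IHn; rewrite k0.
Qed.

Lemma harm_den_dvd (n : nat) : harm_den n %| lcm_upto n.
Proof.
have [N hN] : exists N : nat, ((lcm_upto n)%:R * harmonic n = N%:R :> rat)%R.
  rewrite /harmonic mulr_sumr.
  exists (\sum_(1 <= k < n.+1) lcm_upto n %/ k).
  rewrite natr_sum; apply: eq_big_nat => k /andP[k0 kn].
  have dk : k %| lcm_upto n by apply: dvdn_lcm_upto; rewrite k0 -ltnS.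
  rewrite -{1}(divnK dk) natrM mulfK //.
  by rewrite Num.Theory.pnatr_eq0 -lt0n.
have d0 : ((harm_den n)%:R != 0 :> rat)%R.
  by rewrite Num.Theory.pnatr_eq0 -lt0n absz_gt0 denq_neq0.
have e : lcm_upto n * harm_num n = N * harm_den n.
  apply/eqP; rewrite -(Num.Theory.eqr_nat rat) !natrM -hN harm_numdenE.
  by rewrite mulrA mulfVK.
rewrite -(@Gauss_dvdl _ _ (harm_num n)) ?e ?dvdn_mull //.
by rewrite coprime_sym coprime_harm.
Qed.

Lemma harm_quoK (n : nat) : harm_quo n * harm_den n = lcm_upto n.
Proof. exact: divnK (harm_den_dvd n). Qed.

Lemma harm_quo_gt0 (n : nat) : 0 < harm_quo n.
Proof. by have := lcm_upto_gt0 n; rewrite -harm_quoK muln_gt0 => /andP[]. Qed.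

(* Main.v *)
(* Let L = lcm(1..n) and S = \sum_(k <= n) L/k, so that S/L = c_n/d_n and
   gcd(S, L) = q_n. If m p^a <= n < (m+1) p^a with 0 < m < p, the exact power
   of p in L is p^a, so modulo p only the terms k = j p^a with j <= m survive
   in S, and S = (L/p^a) H_m there. As p divides neither L/p^a nor d_m, it
   divides S exactly when it divides c_m. *)
Require Import Defs.
From mathcomp Require Import all_boot all_order all_algebra.

(** Any common multiple [L] of 1..n is allowed: besides [lcm_upto n], the cofactor of [p ^ a] in it
    and the trivial case [L = n = 1] are used below. *)
Lemma sum_divn_harm (L n : nat) :
  (forall k, 0 < k <= n -> k %| L) ->
  (\sum_(1 <= k < n.+1) L %/ k) * harm_den n = L * harm_num n.
Proof.
move=> dvL.
have d0 : ((harm_den n)%:R != 0 :> rat)%R.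
  by rewrite Num.Theory.pnatr_eq0 -lt0n absz_gt0 denq_neq0.
apply/eqP; rewrite -(Num.Theory.eqr_nat rat) !GRing.natrM; apply/eqP.
transitivity (L%:R * harmonic n * (harm_den n)%:R : rat)%R; last first.
  by rewrite harm_numdenE -GRing.mulrA GRing.mulfVK.
congr (_ * _)%R; rewrite /harmonic GRing.mulr_sumr GRing.natr_sum.
apply: eq_big_nat => k /andP[k0 kn].
rewrite -{2}(divnK (dvL k _)) ?k0 // GRing.natrM GRing.mulfK //.
by rewrite Num.Theory.pnatr_eq0 -lt0n.
Qed.

(** The [p]-valuation of an lcm is the largest one among its arguments, so [p ^ e] divides some
    [k <= n]. With [e = 0] this would fail at [n = 0], where the empty lcm is 1. *)
Lemma pfactor_dvdn_lcm_upto (p e n : nat) :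
  prime p -> 0 < e -> p ^ e %| lcm_upto n -> p ^ e <= n.
Proof.
move=> p_pr e0; elim: n => [|n IHn].
  by rewrite /lcm_upto big_geq // dvdn1 -(expn0 p) eqn_exp2l ?prime_gt1 //;
     case: e e0.
rewrite /lcm_upto big_nat_recr //= -/(lcm_upto n).
have L0 := lcm_upto_gt0 n.
rewrite pfactor_dvdn ?lcmn_gt0 ?L0 // logn_lcm // leq_max -!pfactor_dvdn //.
by case/orP=> [/IHn /leqW // | /dvdn_leq]; apply.
Qed.

Lemma sum_dvdn (d n : nat) (F : nat -> nat) : 0 < d ->
  \sum_(1 <= k < n.+1 | d %| k) F k = \sum_(1 <= j < (n %/ d).+1) F (j * d).
Proof.
move=> d0; elim: n => [|n IHn]; first by rewrite div0n !big_geq.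
rewrite big_mkcond big_nat_recr //= -big_mkcond IHn divnS //.
case: ifP => [dn | _]; last by rewrite addn0.
rewrite add1n [RHS]big_nat_recr //=; congr (_ + F _).
by rewrite -[in LHS](divnK dn) divnS // dn.
Qed.

(** The sum is [harm_quo n * harm_num n] and the lcm is [harm_quo n * harm_den n]; by coprimality
    their gcd is [harm_quo n]. *)
Lemma dvdn_harm_quo (p n : nat) :
  (p %| harm_quo n) =
  (p %| lcm_upto n) && (p %| \sum_(1 <= k < n.+1) lcm_upto n %/ k).
Proof.
have d0 : 0 < harm_den n by rewrite absz_gt0 denq_neq0.
have -> : \sum_(1 <= k < n.+1) lcm_upto n %/ k = harm_quo n * harm_num n.
  apply/eqP; rewrite -(eqn_pmul2r d0) sum_divn_harm; last exact: dvdn_lcm_upto.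
  by rewrite -harm_quoK mulnAC.
rewrite -dvdn_gcd -{1}harm_quoK -muln_gcdr gcdnC.
by rewrite (eqP (coprime_harm n)) muln1.
Qed.

(** The case [m = 1] is included because the converse applies this before excluding it. *)
Lemma dvdn_harm_quo_block (p m a n : nat) :
  prime p -> 0 < m < p -> 0 < a -> m * p ^ a <= n < m.+1 * p ^ a ->
  (p %| harm_quo n) = (p %| harm_num m).
Proof.
move=> p_pr /andP[m0 mp] a0 /andP[mn nm].
have pa0 : 0 < p ^ a by rewrite expn_gt0 prime_gt0.
have nE : n %/ p ^ a = m.
  by apply/eqP; rewrite eqn_leq leq_divRL // mn andbT -ltnS ltn_divLR.
set L := lcm_upto n.
have paL : p ^ a %| L.
  by apply: dvdn_lcm_upto; rewrite pa0 (leq_trans _ mn) // leq_pmull.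
have npaL : ~~ (p ^ a.+1 %| L).
  apply/negP => /(pfactor_dvdn_lcm_upto p a.+1 _ p_pr isT).
  by rewrite leqNgt (leq_trans nm) // expnS leq_mul2r mp orbT.
have [M ME] := dvdnP paL.
have npM : coprime p M.
  rewrite prime_coprime //; apply: contra npaL => pM.
  by rewrite ME expnS dvdn_pmul2r.
have npd : coprime p (harm_den m).
  rewrite prime_coprime //; apply/negP => /dvdn_trans/(_ (harm_den_dvd m)).
  rewrite -{1}(expn1 p) => /(pfactor_dvdn_lcm_upto p 1 _ p_pr isT).
  by rewrite expn1 leqNgt mp.
rewrite dvdn_harm_quo -/L (dvdn_trans _ paL) ?dvdn_exp //=.
(* If [p] did not divide [L %/ k], then [p ^ a], a divisor of [L %/ k * k], would divide [k]. *)
rewrite (bigID (fun k => p ^ a %| k)) /= dvdn_addl; last first.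
  rewrite big_nat_cond; apply: dvdn_sum => k /andP[/andP[k0 kn] nk].
  have kL : k %| L by apply: dvdn_lcm_upto; rewrite k0.
  have := paL; rewrite -{1}(divnK kL) => paLk.
  apply/negPn; apply: contra nk; rewrite -prime_coprime // => npLk.
  by rewrite -(Gauss_dvdr _ (coprimeXl a npLk)).
rewrite sum_dvdn // nE.
under eq_bigr do rewrite mulnC divnMA ME mulnK //.
(* Multiplying by [harm_den m] turns the sum into [M * harm_num m], and [p] is coprime to both
   factors [harm_den m] and [M]. What remains is [k %| M], which holds as [k * p ^ a <= n]. *)
rewrite -(Gauss_dvdl _ npd) sum_divn_harm ?Gauss_dvdr // => k /andP[k0 km].
rewrite -(dvdn_pmul2r pa0) -ME; apply: dvdn_lcm_upto.
by rewrite muln_gt0 k0 pa0 (leq_trans _ mn) // leq_mul2r km orbT.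
Qed.

Theorem theorem2 (p : nat) (p_prime : prime p) (p_odd : odd p) :
  (forall m : nat, m \in E_set p ->
     forall n : nat,
       (exists a : nat, 1 <= a /\ m * p ^ a <= n < (m + 1) * p ^ a) ->
       n \in Q_set p)
  /\
  (forall n : nat, n \in Q_set p ->
     exists m a : nat,
       [/\ m \in E_set p, 1 <= a & m * p ^ a <= n < (m + 1) * p ^ a]).
Proof.
split=> [m /andP[/andP[m1 mp] pm] n [a [a1]] | n /andP[n0 pq]].
  rewrite addn1 => mna; have m0 := ltnW m1; apply/andP; split.
    case/andP: mna => mn _; apply: leq_trans mn.
    by rewrite muln_gt0 m0 expn_gt0 prime_gt0.
  by rewrite (dvdn_harm_quo_block p m a) ?m0.
have p1 := prime_gt1 p_prime.
(* [m] is the leading digit of [n] in base [p]. *)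
set a := trunc_log p n; set m := n %/ p ^ a.
have pa0 : 0 < p ^ a by rewrite expn_gt0 prime_gt0.
have /andP[pan npa] := trunc_log_bounds p1 n0.
(* If [a = 0] then [n < p], and [p] cannot divide the lcm. *)
have a0 : 0 < a.
  rewrite lt0n; apply/eqP => a0; move: npa; rewrite -/a a0 expn1 ltnNge.
  move: pq; rewrite dvdn_harm_quo => /andP[pL _].
  by rewrite -{1}(expn1 p) (pfactor_dvdn_lcm_upto p 1) // expn1.
have m0 : 0 < m by rewrite divn_gt0.
have mp : m < p by rewrite ltn_divLR // -expnS.
have mna : m * p ^ a <= n < m.+1 * p ^ a by rewrite leq_divM ltn_ceil.
have pm : p %| harm_num m by rewrite -(dvdn_harm_quo_block p m a n) ?m0.
exists m, a; split; rewrite ?addn1 //; apply/andP; split=> //.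
(* Only [m = 1] is left to exclude: there the numerator is 1, which [p] does not divide. *)
rewrite /= mp andbT ltn_neqAle m0 andbT; apply/eqP => m1.
have := harm_den_dvd m; move: pm (sum_divn_harm 1 1).
rewrite -m1 /lcm_upto !big_nat1 !div.divn1 dvdn1 => pm E /eqP dE.
move: pm; rewrite -(mul1n (harm_num 1)) -E ?dE => [|k]; last by case: k => [|[]].
by rewrite dvdn1 => /eqP pE; rewrite pE in p1.
Qed.
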